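(* Let $G=\left\{\begin{pmatrix} a&b\\0&a^{-1}\end{pmatrix}: a>0,\ b\in\mathbb R\right\}$, let $p,q\in\mathbb R$ with $p\neq0,-1$, and let $D:G\to G$ be the crossed homomorphism with respect to the conjugation action given by $$D\begin{pmatrix} a&b\\0&a^{-1}\end{pmatrix}=\begin{pmatrix}a^{p}&q\frac{a^{2+p}-a^{-p}}{2(p+1)}-ba^{1+p}\\0&a^{-p}\end{pmatrix}.$$ Let $\mathcal D:G\times\mathbb R\to G$ be a deformation of $D$, and let $\epsilon>0$ and smooth functions $g,h:(-\epsilon,\epsilon)\to\mathbb R$ with $g(0)=p$, $h(0)=q$ and $g(s)\ne0,-1$ for all $s\in(-\epsilon,\epsilon)$ be such that $$\mathcal D\left(\begin{pmatrix} a&b\\0&a^{-1}\end{pmatrix},s\right)=\begin{pmatrix}a^{g(s)}&h(s)\frac{a^{2+g(s)}-a^{-g(s)}}{2(g(s)+1)}-ba^{1+g(s)}\\0&a^{-g(s)}\end{pmatrix}\quad\text{for all }\begin{pmatrix} a&b\\0&a^{-1}\end{pmatrix}\in G,\ s\in(-\epsilon,\epsilon)$$ (for every deformation of $D$ such $\epsilon$, $g$, $h$ exist). If there exists an open interval $I\subset(-\epsilon,\epsilon)$ such that $g'(s)=0$ for all $s\in I$, then the deformation $\mathcal D$ is trivial. Otherwise, the deformation $\mathcal D$ is nontrivial.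
   Context: A crossed homomorphism with respect to the conjugation action on a Lie group $G$ is a smooth map $D:G\to G$ satisfying $D(xy)=D(x)\,x\,D(y)\,x^{-1}$ for all $x,y\in G$. A deformation of $D$ is a smooth map $\mathcal D:G\times\mathbb R\to G$ such that $\mathcal D(\cdot,0)=D$ and $\mathcal D(\cdot,t)$ is such a crossed homomorphism for every $t\in\mathbb R$. It is trivial if there are an interval $(-\varepsilon,\varepsilon)\subset\mathbb R$ and a smooth map $\tau:(-\varepsilon,\varepsilon)\to G$ with $\tau(0)$ the identity and $\mathcal D(x,t)=\tau(t)\,D(x)\,x\,\tau(t)^{-1}\,x^{-1}$ for all $x\in G$, $t\in(-\varepsilon,\varepsilon)$; it is nontrivial if it is not trivial.
   Formalization: The open interval I is required to contain 0; for an interval away from 0 the first claim fails, e.g. when g is constant on (1/2,3/4) but not constant near 0. *)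

(* Defs.v *)
From mathcomp Require Import all_boot all_order all_algebra.
From mathcomp Require Import all_classical all_reals all_analysis.

Set Implicit Arguments.
Unset Strict Implicit.
Unset Printing Implicit Defensive.

Import Order.TTheory GRing.Theory Num.Theory numFieldNormedType.Exports.

Local Open Scope classical_set_scope.
Local Open Scope ring_scope.

(* [U] is meant to be open and [V] finite-dimensional; then [Ck k U f] is the
   usual notion of a C^k map on [U]: the map [f] is continuous, and if 0 < k it
   is differentiable with all its directional derivatives of class C^(k-1).
   Values of [f] outside [U] are irrelevant since [U] is open. *)
Fixpoint Ck (R : realType) (V W : normedModType R) (k : nat) (U : set V)
    (f : V -> W) : Prop :=
  match k with
  | 0%N => forall x, U x -> {for x, continuous f}
  | j.+1 => (forall x, U x -> differentiable f x) /\
            (forall v : V, Ck j U (fun x => 'D_v f x))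
  end.

Definition smooth_on (R : realType) (V W : normedModType R) (U : set V)
    (f : V -> W) : Prop :=
  forall k : nat, Ck k U f.

(* The matrix with rows (a, b) and (c, d). *)
Definition mx22 (R : realType) (a b c d : R) : 'M[R]_2 :=
  \matrix_(i < 2, j < 2)
    if i == 0 then (if j == 0 then a else b) else (if j == 0 then c else d).

(* The group G, as a subset of the ring of 2x2 matrices; its product, unit and
   inverse are those of that ring.  Maps defined on G are represented by
   functions on all of ['M[R]_2] whose values outside G are never used. *)
Definition G (R : realType) : set 'M[R]_2 :=
  [set A | exists a b : R, 0 < a /\ A = mx22 a b 0 a^-1].

(* Smoothness of maps from G, resp. G x R, to G.  The source is read in the
   global chart (a, b) of G, with range {a > 0}.  As G is an embedded
   submanifold of the space of matrices, smoothness of a G-valued map is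
   smoothness as a matrix-valued map. *)
Definition smooth_G (R : realType) (D : 'M[R]_2 -> 'M[R]_2) : Prop :=
  smooth_on [set u : R * R | 0 < u.1]
    (fun u => D (mx22 u.1 u.2 0 u.1^-1)).

Definition smooth_GR (R : realType) (DD : 'M[R]_2 -> R -> 'M[R]_2) : Prop :=
  smooth_on [set u : R * R * R | 0 < u.1.1]
    (fun u => DD (mx22 u.1.1 u.1.2 0 u.1.1^-1) u.2).

Definition crossed_hom (R : realType) (D : 'M[R]_2 -> 'M[R]_2) : Prop :=
  [/\ forall x, G x -> G (D x),
      smooth_G D &
      forall x y, G x -> G y -> D (x * y) = D x * x * D y * x^-1].

Definition deformation (R : realType) (D : 'M[R]_2 -> 'M[R]_2)
    (DD : 'M[R]_2 -> R -> 'M[R]_2) : Prop :=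
  [/\ smooth_GR DD,
      forall x, G x -> DD x 0 = D x &
      forall t : R, crossed_hom (fun x => DD x t)].

Definition trivial_deformation (R : realType) (D : 'M[R]_2 -> 'M[R]_2)
    (DD : 'M[R]_2 -> R -> 'M[R]_2) : Prop :=
  exists (e : R) (tau : R -> 'M[R]_2),
    [/\ 0 < e,
        smooth_on `]- e, e[ tau /\ (forall t, t \in `]- e, e[ -> G (tau t)),
        tau 0 = 1 &
        forall x t, G x -> t \in `]- e, e[ ->
          DD x t = tau t * D x * x * (tau t)^-1 * x^-1].

Definition Dpq (R : realType) (p q : R) (A : 'M[R]_2) : 'M[R]_2 :=
  let a := A 0 0 in
  let b := A 0 1 in
  mx22 (a `^ p)
       (q * ((a `^ (2 + p) - a `^ (- p)) / (2 * (p + 1))) - b * a `^ (1 + p))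
       0
       (a `^ (- p)).

(* eps, g, h describe the deformation DD of Dpq p q for small parameters. *)
Definition local_form (R : realType) (p q : R) (DD : 'M[R]_2 -> R -> 'M[R]_2)
    (eps : R) (g h : R -> R) : Prop :=
  [/\ 0 < eps,
      smooth_on `]- eps, eps[ g /\ smooth_on `]- eps, eps[ h,
      g 0 = p /\ h 0 = q,
      forall s, s \in `]- eps, eps[ -> g s <> 0 /\ g s <> -1 &
      forall x s, G x -> s \in `]- eps, eps[ -> DD x s = Dpq (g s) (h s) x].

(* g' vanishes identically on some open interval I = ]c, d[ contained in
   ]- eps, eps[.  The interval I is a neighbourhood of the base point 0 of the
   deformation: triviality only concerns parameters near 0, so the behaviour of
   g on an interval away from 0 is irrelevant to it. *)
Definition derivative_vanishes (R : realType) (eps : R) (g : R -> R) : Prop :=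
  exists c d : R,
    [/\ c < 0 < d,
        `]c, d[ `<=` `]- eps, eps[ &
        forall s, s \in `]c, d[ -> derive1 g s = 0].

(* Main.v *)
From HB Require Import structures.
Require Import Defs.
From mathcomp Require Import all_boot all_order all_algebra.
From mathcomp Require Import all_classical all_reals all_analysis.
From mathcomp Require Import ring lra.
Import Order.TTheory GRing.Theory Num.Theory numFieldNormedType.Exports.
Local Open Scope classical_set_scope.
Local Open Scope ring_scope.

(** Multiplying the crossed homomorphism identity on the right by [x * y] turns
    it into the statement that [F x = D x * x] is an endomorphism of [G].
    For [D = Dpq p q] and [m = p + 1], the endomorphism [F] sends the matrix
    with diagonal [a, 1/a] and corner [b] to the one with diagonal
    [a^m, a^(-m)] and corner [q * (a^m - a^(-m)) / (2 * m)], whatever [b] is.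

    Existence of [g] and [h].  The diagonal part of an endomorphism of [G] is
    trivial on unipotent matrices and equals [a^m] on diagonal ones.
    Conjugation by diagonal matrices multiplies the corner of a unipotent matrix
    by [a^2] in the source and by [a^(2m)] in the target, so unipotents are
    killed unless [m = 1]; the endomorphism then factors through the abelian
    group of diagonal matrices, and commutation in the image forces the corner
    to be proportional to [a^m - a^(-m)] if [m <> 0] ([endomorphism_form]).
    Hence a crossed homomorphism whose diagonal part is [a^g], with [g] (its
    rate) different from 0 and -1, has the form [Dpq g h],
    and both [g] and [h] are explicit functions of its value at the single
    matrix with diagonal [e, 1/e] ([crossed_hom_Dpq]).  Along a deformation
    this value is a smooth function of the parameter; the rate is [p] at
    parameter 0, and so stays away from 0 and -1 nearby
    ([deformation_local_form]).

    Triviality.  In terms of [F], a trivial deformation is a conjugation of the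
    endomorphism by a curve in [G].  Conjugation does not change the diagonal,
    so it keeps the rate [g] constant.  Conversely, if [g] is constant near 0,
    conjugation by the unipotent matrix with corner [u] adds
    [u * (a^(-m) - a^m)] to the corner of [F], which changes [q] into
    [q - 2 * m * u]; the choice [u = (q - h s) / (2 * m)] reaches [h s]. *)

(** * Calculus of maps of class C^k on an open set of reals *)

Section Calculus.
Set Implicit Arguments.
Unset Strict Implicit.
Context {R : realType}.
Implicit Types (U : set R) (W : normedModType R) (k : nat).

(** Rules of differentiation give the directional derivatives of a combination
    of maps only at the points of [U]; this lemma lets them be used inside the
    induction on [k].  Openness of [U] makes derivatives on [U] depend only on
    values on [U]. *)
Lemma Ck_ext W k U (f g : R -> W) : open U -> {in U, f =1 g} ->
  Ck k U f -> Ck k U g.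
Proof.
move=> oU; elim: k f g => [|k IH] f g fg; have nfg x : U x -> {near x, f =1 g}.
- move=> Ux; apply: filterS (open_nbhs_nbhs (conj oU Ux)) => z Uz.
  by apply: fg; rewrite inE.
- move=> fc x Ux; rewrite /prop_for /continuous_at -(fg x) ?inE//.
  by apply: cvg_trans (fc x Ux); exact: near_eq_cvg (nfg x Ux).
- move=> Ux; apply: filterS (open_nbhs_nbhs (conj oU Ux)) => z Uz.
  by apply: fg; rewrite inE.
move=> [df Df]; split=> [x Ux|v].
  apply/derivable1_diffP; apply: near_eq_derivable (nfg x Ux) _.
  exact/derivable1_diffP/df.
apply: (IH ('D_v f)) (Df v) => // x; rewrite inE => Ux.
exact: near_eq_derive (nfg x Ux).
Qed.

Lemma Ck_pred W k U (f : R -> W) : Ck k.+1 U f -> Ck k U f.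
Proof.
elim: k f => [|k IH] f [df Df]; first by move=> x /df/differentiable_continuous.
by split=> // v; apply: IH.
Qed.

Lemma Ck_subset W k U U' (f : R -> W) : U `<=` U' -> Ck k U' f -> Ck k U f.
Proof.
move=> UU'; elim: k f => [|k IH] f; first by move=> fc x /UU'; exact: fc.
by move=> [df Df]; split=> [x /UU'|v]; [exact: df|exact: IH (Df v)].
Qed.

Lemma Ck_cst W k U (w : W) : Ck k U (cst w).
Proof.
elim: k w => [|k IH] w; first by move=> x _; exact: cst_continuous.
split=> [x _|v]; first exact: differentiable_cst.
by under eq_fun do rewrite derive_cst; apply: IH.
Qed.

Lemma Ck_lin W W' k U (L : {linear W -> W'}) (f : R -> W) :
  continuous L -> open U -> Ck k U f -> Ck k U (L \o f).
Proof.
move=> cL oU; elim: k f => [|k IH] f.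
  by move=> fc x Ux; apply: continuous_comp; [exact: fc|exact: cL].
have dL y : differentiable L y by exact: linear_differentiable.
move=> [df Df]; split=> [x Ux|v].
  by apply: differentiable_comp; [exact: df|].
apply: (@Ck_ext _ _ _ (L \o 'D_v f)) (IH _ (Df v)) => // x.
rewrite inE => Ux /=; have dfx := df _ Ux.
rewrite !deriveE//; last exact: differentiable_comp.
by rewrite [in RHS]diff_comp//= diff_lin.
Qed.

Lemma CkD W k U (f g : R -> W) : open U ->
  Ck k U f -> Ck k U g -> Ck k U (f + g).
Proof.
move=> oU; elim: k f g => [|k IH] f g.
  by move=> fc gc x Ux; apply: cvgD; [exact: fc|exact: gc].
move=> [df Df] [dg Dg]; split=> [x Ux|v].
  by apply: differentiableD; [exact: df|exact: dg].
apply: (@Ck_ext _ _ _ ('D_v f + 'D_v g)) (IH _ _ (Df v) (Dg v)) => // x.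
rewrite inE => Ux /=.
by rewrite deriveD//; apply: diff_derivable; [exact: df|exact: dg].
Qed.

Lemma CkM k U (f g : R -> R) : open U ->
  Ck k U f -> Ck k U g -> Ck k U (f * g).
Proof.
move=> oU; elim: k f g => [|k IH] f g.
  by move=> fc gc x Ux; apply: cvgM; [exact: fc|exact: gc].
move=> Cf Cg; have [df Df] := Cf; have [dg Dg] := Cg; split=> [x Ux|v].
  exact: (differentiableM (df _ Ux) (dg _ Ux)).
apply: (@Ck_ext _ _ _ (f * 'D_v g + g * 'D_v f)) => //; last first.
  by apply: CkD => //; apply: IH; (exact: Ck_pred || exact: Df || exact: Dg).
move=> x; rewrite inE => Ux.
by rewrite deriveM//; apply: diff_derivable; [exact: df|exact: dg].
Qed.

Lemma CkN W k U (f : R -> W) : open U -> Ck k U f -> Ck k U (- f).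
Proof.
move=> oU; elim: k f => [|k IH] f.
  by move=> fc x Ux; apply: cvgN; exact: fc.
move=> [df Df]; split=> [x Ux|v].
  by apply: differentiableN; exact: df.
apply: (@Ck_ext _ _ _ (- 'D_v f)) (IH _ (Df v)) => // x.
by rewrite inE => Ux /=; rewrite deriveN//; apply: diff_derivable; exact: df.
Qed.

Lemma CkV k U (f : R -> R) : open U -> (forall x, U x -> f x != 0) ->
  Ck k U f -> Ck k U (fun x => (f x)^-1).
Proof.
move=> oU f0; elim: k f f0 => [|k IH] f f0.
  by move=> fc x Ux; apply: cvgV; [exact: f0|exact: fc].
move=> Cf; have [df Df] := Cf; split=> [x Ux|v].
  by apply: differentiableV; [exact: df|exact: f0].
pose g x := (f x)^-1.
apply: (@Ck_ext _ _ _ (- (g * g * 'D_v f))) => //; last first.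
  have Cg : Ck k U g := IH _ f0 (Ck_pred Cf).
  exact: CkN (CkM _ (CkM _ Cg Cg) (Df v)).
move=> x; rewrite inE => Ux.
rewrite deriveV; [|exact: f0|exact/diff_derivable/df].
by rewrite scaleNr -exprVn expr2.
Qed.

Lemma Ck_ln k U (f : R -> R) : open U -> (forall x, U x -> 0 < f x) ->
  Ck k U f -> Ck k U (fun x => ln (f x)).
Proof.
move=> oU f0; case: k f f0 => [|k] f f0.
  move=> fc x Ux; apply: continuous_comp; first exact: fc.
  exact/continuous_ln/f0.
move=> Cf; have [df Df] := Cf.
have dln (y : R) : 0 < y -> differentiable (@ln R) y.
  by move=> y0; apply/derivable1_diffP; apply: ex_derive; apply: is_derive1_ln.
split=> [x Ux|v].
  by apply: differentiable_comp; [exact: df|exact/dln/f0].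
apply: (@Ck_ext _ _ _ ((fun x => (f x)^-1) * 'D_v f)) => //; last first.
  apply: CkM (Df v) => //; apply: CkV (Ck_pred Cf) => //.
  by move=> x Ux; rewrite gt_eqF// f0.
move=> x; rewrite inE => Ux /=.
have dl := dln _ (f0 _ Ux); have dfx := df _ Ux.
have [_ lnE] := is_derive1_ln (f0 _ Ux).
rewrite [RHS]deriveE; last exact: differentiable_comp.
rewrite [in RHS]diff_comp//= -(deriveE v dfx).
rewrite -[X in 'd _ _ X]mulr1 [RHS]linearZ/= -(deriveE (1 : R) dl) lnE.
exact: mulrC.
Qed.

(** The derivative of the restriction in direction [w] is the restriction of the
    derivative of [f] in the fixed direction [w *: v], so the induction
    applies to it. *)
Lemma Ck_line (V W : normedModType R) k U (U' : set V) (f : V -> W) (x v : V) :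
  open U -> (forall s, U s -> U' (x + s *: v)) ->
  Ck k U' f -> Ck k U (fun s => f (x + s *: v)).
Proof.
move=> oU UU'.
have dl s : is_diff s (fun s : R => x + s *: v) ( *:%R^~ v).
  have := is_diffD (is_diff_cst x s) (is_diff_scalel s v).
  by rewrite add0r.
elim: k f => [|k IH] f.
  move=> fc s Us.
  apply: (@continuous_comp _ _ _ (fun s : R => x + s *: v) f).
    by apply: differentiable_continuous; have [] := dl s.
  exact/fc/UU'.
move=> [df Df]; split=> [s Us|w].
  apply: (@differentiable_comp _ _ _ _ (fun s : R => x + s *: v) f).
    by have [] := dl s.
  exact/df/UU'.
apply: (@Ck_ext _ _ _ (fun s => 'D_(w *: v) f (x + s *: v))) => //; last first.
  exact: IH (Df (w *: v)).
move=> s; rewrite inE => Us.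
have [dls dlE] := dl s; have dfs := df _ (UU' _ Us).
rewrite !deriveE//; last first.
  exact: (@differentiable_comp _ _ _ _ (fun s : R => x + s *: v) f).
by rewrite (@diff_comp _ _ _ _ (fun s : R => x + s *: v) f)//= dlE.
Qed.

Lemma Ck_entry k (U : set R) (f : R -> 'M[R]_2) (i j : 'I_2) :
  open U -> Ck k U f -> Ck k U (fun s => f s i j).
Proof.
move=> oU Cf.
pose L (N : 'M[R]_2) : R := N i j.
have Llin : linear L by move=> a u v; rewrite /L !mxE.
pose LM := GRing.isLinear.Build _ _ _ _ _ Llin.
pose LL : {linear 'M[R]_2 -> R} := HB.pack L LM.
apply: (Ck_lin (L := LL) _ oU Cf).
exact: coord_continuous.
Qed.

Lemma Ck_scalel (W : normedModType R) k (U : set R) (f : R -> R) (w : W) :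
  open U -> Ck k U f -> Ck k U (fun s => f s *: w).
Proof.
move=> oU Cf.
pose L (r : R) : W := r *: w.
have Llin : linear L by move=> a u v; rewrite /L scalerDl scalerA.
pose LM := GRing.isLinear.Build _ _ _ _ _ Llin.
pose LL : {linear R -> W} := HB.pack L LM.
apply: (Ck_lin (L := LL) _ oU Cf).
exact: scalel_continuous.
Qed.
(** Additivity makes all difference quotients independent of the base point, so
    the derivative of [f] is constant. *)
Lemma derivable_additive_linear (f : R -> R) :
  (forall x y, f (x + y) = f x + f y) -> (forall x, derivable f x 1) ->
  forall x, f x = x * f 1.
Proof.
move=> fD df.
have f0 : f 0 = 0 by have /eqP := fD 0 0; rewrite addr0 -subr_eq subrr => /eqP.
have Df x : 'D_1 f x = 'D_1 f 0.
  rewrite /derive.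
  rewrite (_ : (fun h => _) =
    fun h : R => h^-1 *: ((f \o shift 0) (h *: 1) - f 0))//.
  by apply/funext => y /=; rewrite !fD f0 addr0 addrK subr0.
set c := 'D_1 f 0 in Df.
have g0 x : is_derive x (1 : R) (fun y => f y - y * c) 0.
  have fx : is_derive x (1 : R) f c by rewrite -(Df x); exact: derivableP.
  have idc : is_derive x (1 : R) (fun y => y * c) c.
    have := @is_deriveM _ _ id (cst c) x 1 1 0
      (is_derive_id _ _) (is_derive_cst _ _ _).
    by rewrite scaler0 add0r /cst /GRing.scale/= mulr1.
  by have := is_deriveB fx idc; rewrite subrr.
have fE x : f x = x * c.
  have := is_derive_0_is_cst x 0 g0.
  by rewrite f0 mul0r subrr => /eqP; rewrite subr_eq0 => /eqP.
by move=> x; rewrite (fE 1) mul1r.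
Qed.

(** In logarithmic coordinates a multiplicative function is additive. *)
Lemma multiplicative_powR (f : R -> R) :
  (forall a : R, 0 < a -> 0 < f a) ->
  (forall a b : R, 0 < a -> 0 < b -> f (a * b) = f a * f b) ->
  (forall a : R, 0 < a -> differentiable f a) ->
  forall a : R, 0 < a -> f a = a `^ ln (f (expR 1)).
Proof.
move=> f0 fM df a a0.
have eP (t : R) : 0 < expR t := expR_gt0 t.
have /(_ (ln a)) : forall t, ln (f (expR t)) = t * ln (f (expR 1)).
  apply: (@derivable_additive_linear (fun t => ln (f (expR t)))) => [x y|x].
    by rewrite expRD fM// lnM// posrE f0.
  apply/derivable1_diffP.
  apply: (@differentiable_comp _ _ _ _ (f \o expR) (@ln R)).
    apply: differentiable_comp; last exact: df.
    by apply/derivable1_diffP; exact: derivable_expR.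
  by apply/derivable1_diffP; apply: ex_derive; apply: is_derive1_ln; exact: f0.
rewrite lnK ?posrE// => H.
by apply: ln_inj; rewrite ?posrE ?f0 ?powR_gt0// ln_powR H mulrC.
Qed.

Lemma derive0_cst (f : R -> R) (c d : R) :
  (forall x, x \in `]c, d[ -> is_derive x (1 : R) f 0) ->
  {in `]c, d[ &, forall x y, f x = f y}.
Proof.
move=> f'0 x y; wlog xy : x y / x <= y => [H xI yI|xI yI].
  by have [xy|/ltW yx] := leP x y; [|apply/esym]; apply: H.
have sub z : z \in `[x, y] -> z \in `]c, d[.
  move: xI yI; rewrite !in_itv/= => /andP[cx _] /andP[_ yd] /andP[xz zy].
  by rewrite (lt_le_trans cx xz) (le_lt_trans zy yd).
have df z : z \in `]x, y[ -> is_derive z (1 : R) f 0.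
  rewrite in_itv/= => /andP[/ltW xz /ltW zy]; apply/f'0/sub.
  by rewrite in_itv/= xz zy.
have cf : {within `[x, y], continuous f}.
  apply: derivable_within_continuous => z zI.
  by have [] := f'0 _ (sub _ zI).
have [z _] := MVT_segment xy df cf.
by rewrite mul0r => /eqP; rewrite subr_eq0 => /eqP.
Qed.

End Calculus.

(** * Endomorphisms of the group of triangular matrices *)

Section Triangular.
Set Implicit Arguments.
Unset Strict Implicit.
Context {R : realType}.
Implicit Types a b c d p q : R.

Lemma mx22_00 a b c d : mx22 a b c d 0 0 = a. Proof. by rewrite mxE. Qed.
Lemma mx22_01 a b c d : mx22 a b c d 0 1 = b. Proof. by rewrite mxE. Qed.

Lemma mx22M a b d a' b' d' :
  mx22 a b 0 d * mx22 a' b' 0 d' = mx22 (a * a') (a * b' + b * d') 0 (d * d').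
Proof.
apply/matrixP => -[[|[|//]] ?] [[|[|//]] ?];
  rewrite !mxE !big_ord_recl big_ord0;
  rewrite !mxE /=; ring.
Qed.

Lemma mx22_1 : mx22 1 0 0 1 = 1 :> 'M[R]_2.
Proof. by apply/matrixP => -[[|[|//]] ?] [[|[|//]] ?]; rewrite !mxE. Qed.

Lemma mx22MV a b : a != 0 -> mx22 a b 0 a^-1 * mx22 a^-1 (- b) 0 a = 1.
Proof.
by move=> a0; rewrite mx22M mulfV// mulVf// mulrN (mulrC a) addNr mx22_1.
Qed.

Lemma mx22VM a b : a != 0 -> mx22 a^-1 (- b) 0 a * mx22 a b 0 a^-1 = 1.
Proof.
by move=> a0; rewrite mx22M mulfV// mulVf// mulNr (mulrC _^-1) subrr mx22_1.
Qed.

Lemma mx22_unit a b : a != 0 -> mx22 a b 0 a^-1 \is a GRing.unit.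
Proof.
move=> a0; apply/unitrP; exists (mx22 a^-1 (- b) 0 a).
by rewrite mx22MV// mx22VM.
Qed.

Lemma mx22V a b : a != 0 -> (mx22 a b 0 a^-1)^-1 = mx22 a^-1 (- b) 0 a.
Proof.
by move=> a0; rewrite -[RHS](mulKr (mx22_unit b a0)) mx22MV// mulr1.
Qed.

Lemma Gmx22 a b : 0 < a -> G (mx22 a b 0 a^-1).
Proof. by move=> a0; exists a, b. Qed.

Lemma G_unit (x : 'M[R]_2) : G x -> x \is a GRing.unit.
Proof. by move=> [a [b [a0 ->]]]; rewrite mx22_unit// gt_eqF. Qed.

Lemma G_eta (x : 'M[R]_2) : G x -> 0 < x 0 0 /\
  x = mx22 (x 0 0) (x 0 1) 0 (x 0 0)^-1.
Proof. by move=> [a [b [a0 ->]]]; rewrite mx22_00 mx22_01. Qed.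

(** Here [phi] and [beta] are the upper left and upper right entries of an
    endomorphism of [G], as functions of those of its argument.  The values
    [m = 0] and [m = 1] are genuine exceptions: the image is unipotent in the
    first case, and the identity map has [m = 1]. *)
Lemma endomorphism_form (phi beta : R -> R -> R) :
  (forall a b, 0 < a -> 0 < phi a b) ->
  (forall a b a' b', 0 < a -> 0 < a' ->
     phi (a * a') (a * b' + b * a'^-1) = phi a b * phi a' b') ->
  (forall a b a' b', 0 < a -> 0 < a' ->
     beta (a * a') (a * b' + b * a'^-1) =
     phi a b * beta a' b' + beta a b * (phi a' b')^-1) ->
  (forall a, 0 < a -> differentiable (phi ^~ 0) a) ->
  let m := ln (phi (expR 1) 0) in
  m != 0 -> m != 1 ->
  forall a b, 0 < a -> phi a b = a `^ m /\
    beta a b = beta (expR 1) 0 / (expR m - expR (- m)) * (a `^ m - a `^ (- m)).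
Proof.
move=> f0 fM kM df m m0 m1.
have fa0 a : 0 < a -> phi a 0 = a `^ m.
  move=> a0.
  apply: (@multiplicative_powR _ (phi ^~ 0)) => //= [c|c d] c0; first exact: f0.
  by move=> d0; rewrite -fM// !mulr0 mul0r addr0.
have p2 : 0 < 2 :> R by [].
have f1D b b' : phi 1 (b + b') = phi 1 b * phi 1 b'.
  by rewrite -fM// invr1 !mulr1 mul1r addrC.
(* Conjugation by diag(2, 1/2) multiplies the corner of a unipotent by 4, and
   so does the fourth power, so [phi 1 b] equals its own fourth power. *)
have conj2 b : phi 1 (4 * b) * phi 2 0 = phi 2 0 * phi 1 b.
  rewrite -!fM//; congr (phi _ _); first by rewrite mulrC.
  by rewrite mulr0 invr1 mulr1 add0r addr0; field.
have f1 b : phi 1 b = 1.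
  have : phi 1 b ^+ 3 = 1.
    have := conj2 b; rewrite mulrC => /(mulfI (lt0r_neq0 (f0 2 0 p2))).
    have -> : 4 * b = b + (b + (b + b)) by ring.
    rewrite !f1D => /eqP; rewrite -subr_eq0 => H.
    have fb := f0 1 b ltr01.
    have : phi 1 b * (phi 1 b ^+ 3 - 1) == 0.
      by rewrite -(eqP H); apply/eqP; ring.
    by rewrite mulf_eq0 gt_eqF//= subr_eq0 => /eqP.
  move/eqP; rewrite pexpr_eq1//; last exact/ltW/f0.
  by move/eqP.
have k1D b b' : beta 1 (b + b') = beta 1 b + beta 1 b'.
  have := kM 1 b' 1 b ltr01 ltr01.
  by rewrite !f1 invr1 !mulr1 !mul1r.
have k1 b : beta 1 b = 0.
  have H :
      beta (1 * 2) (1 * 0 + 4 * b * 2^-1) = beta (2 * 1) (2 * b + 0 * 1^-1).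
    by rewrite mulr0 mul0r addr0 add0r mul1r mulr1; congr beta; field.
  move: H; rewrite !kM// !f1 invr1 mul1r mulr1.
  have -> : 4 * b = b + (b + (b + b)) by ring.
  rewrite !k1D fa0// => H.
  have t0 : 0 < (2 : R) `^ m by rewrite powR_gt0.
  have tn0 := lt0r_neq0 t0.
  (* The factors of the conjugation by diag(2, 1/2) on corners in source and
     target, 4 and (2^m)^2, differ. *)
  have tn2 : (2 : R) `^ m != 2.
    apply/negP => /eqP /(congr1 (@ln R)); rewrite ln_powR => /eqP.
    rewrite -[X in _ == X]mul1r.
    have l2 : 0 < ln (2 : R) by rewrite ln_gt0// ltr1n.
    by rewrite (inj_eq (mulIf (lt0r_neq0 l2))) (negbTE m1).
  set t := _ `^ m in H t0 tn0 tn2.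
  have : beta 1 b * ((2 - t) * (2 + t)) = 0.
    have {}H : (4 * beta 1 b) * t^-1 = t * beta 1 b by lra.
    by have := congr1 ( *%R^~ t) H; rewrite mulfVK//; lra.
  move/eqP; rewrite !mulf_eq0 subr_eq0 (eq_sym 2) (negbTE tn2)/= orbC.
  by rewrite gt_eqF ?addr_gt0// => /eqP.
have split a b : 0 < a -> phi a b = phi a 0 /\ beta a b = beta a 0.
  move=> a0; have an0 := lt0r_neq0 a0.
  have := fM a 0 1 (b / a) a0 ltr01; have := kM a 0 1 (b / a) a0 ltr01.
  have -> : a * (b / a) + 0 * 1^-1 = b by field.
  by rewrite f1 k1 invr1 !mulr1 mulr0 add0r.
(* The images of diag(a, 1/a) and diag(e, 1/e) commute; writing out the corner
   of their product in both orders gives [beta a 0] in terms of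
   [beta (expR 1) 0]. *)
move=> a b a0; have [-> ->] := split a b a0; split; first exact: fa0.
have e0 : 0 < expR 1 :> R := expR_gt0 1.
have := kM a 0 (expR 1) 0 a0 e0; rewrite mulrC addrC.
rewrite !mulr0 !mul0r addr0 => H.
have := kM (expR 1) 0 a 0 e0 a0; rewrite !mulr0 !mul0r addr0 H => {H}.
rewrite !fa0// -!powRN -!expRM !mul1r => H.
have en0 : expR m - expR (- m) != 0.
  rewrite subr_eq0 (inj_eq (@expR_inj R)) -subr_eq0 opprK -mulr2n mulrn_eq0.
  by rewrite (negbTE m0).
rewrite mulrAC; apply: (canRL (mulfK en0)); lra.
Qed.

Lemma Dpq_mx22 p q a b : 0 < a -> Dpq p q (mx22 a b 0 a^-1) =
  mx22 (a `^ p)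
    (q * ((a ^+ 2 * a `^ p - (a `^ p)^-1) / (2 * (p + 1))) - b * (a * a `^ p))
    0 (a `^ p)^-1.
Proof.
move=> a0; have aD u : a `^ (u + p) = a `^ u * a `^ p.
  by rewrite powRD ?lt0r_neq0 ?implybT.
by rewrite /Dpq mx22_00 mx22_01 !aD powRN powRr1 ?ltW// (powR_mulrn 2) ?ltW.
Qed.

End Triangular.

(** * Crossed homomorphisms with a given rate *)

Section CrossedHomomorphisms.
Set Implicit Arguments.
Unset Strict Implicit.
Context {R : realType}.
Implicit Types a b c d p q : R.

(** Evaluation at base [expR 1] makes the logarithm of the diagonal entry equal
    to the exponent itself. *)
Definition diag_e : 'M[R]_2 := mx22 (expR 1) 0 0 (expR 1)^-1.
(** The parameters [p] and [q] read off from [A = Dpq p q diag_e]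
    (see [rate_Dpq] and [slope_Dpq]); the denominator is
    [expR (2 + p) - expR (- p)]. *)
Definition rate (A : 'M[R]_2) : R := ln (A 0 0).
Definition slope (A : 'M[R]_2) : R :=
  2 * (rate A + 1) * A 0 1 / (expR 1 ^+ 2 * A 0 0 - (A 0 0)^-1).

Lemma slope_denom_neq0 p : p != -1 ->
  expR 1 ^+ 2 * expR p - (expR p)^-1 != 0 :> R.
Proof.
move=> p1; rewrite -expRM_natr mul1r -expRD -expRN subr_eq0.
rewrite (inj_eq (@expR_inj R)).
apply: contraNN p1 => /eqP H; apply/eqP; lra.
Qed.

(** The classification of endomorphisms, applied to [x |-> D x * x], whose
    exponent on diagonal matrices exceeds the rate of [D] by 1. *)
Lemma crossed_hom_Dpq (D : 'M[R]_2 -> 'M[R]_2) : crossed_hom D ->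
  rate (D diag_e) != 0 -> rate (D diag_e) != -1 ->
  forall x, G x -> D x = Dpq (rate (D diag_e)) (slope (D diag_e)) x.
Proof.
move=> [DG Dsm DM] r0 r1.
pose X a b := mx22 a b 0 a^-1.
pose phi a b := D (X a b) 0 0 * a.
pose beta a b := D (X a b) 0 0 * b + D (X a b) 0 1 * a^-1.
have D0 a b : 0 < a -> 0 < D (X a b) 0 0.
  by move=> a0; have [] := G_eta (DG _ (Gmx22 b a0)).
have FE a b : 0 < a ->
    D (X a b) * X a b = mx22 (phi a b) (beta a b) 0 (phi a b)^-1.
  move=> a0; have [d0 {1}->] := G_eta (DG _ (Gmx22 b a0)).
  by rewrite mx22M -invfM.
have FM a b a' b' : 0 < a -> 0 < a' ->
    mx22 (phi (a * a') (a * b' + b * a'^-1))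
      (beta (a * a') (a * b' + b * a'^-1)) 0
      (phi (a * a') (a * b' + b * a'^-1))^-1 =
    mx22 (phi a b * phi a' b')
      (phi a b * beta a' b' + beta a b * (phi a' b')^-1) 0
      ((phi a b)^-1 * (phi a' b')^-1).
  move=> a0 a'0; rewrite -FE ?mulr_gt0// -mx22M -!FE//.
  have -> : X (a * a') (a * b' + b * a'^-1) = X a b * X a' b'.
    by rewrite /X mx22M -invfM.
  rewrite DM; [|exact: Gmx22|exact: Gmx22].
  rewrite -!mulrA; congr (_ * (_ * (_ * _))).
  by rewrite mulKr//; exact/G_unit/Gmx22.
have f0 a b : 0 < a -> 0 < phi a b by move=> a0; rewrite mulr_gt0// D0.
have e0 : 0 < expR 1 :> R := expR_gt0 1.
have mE : ln (phi (expR 1) 0) = rate (D diag_e) + 1.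
  by rewrite lnM ?posrE ?D0// expRK.
have fM a b a' b' : 0 < a -> 0 < a' ->
    phi (a * a') (a * b' + b * a'^-1) = phi a b * phi a' b'.
  move=> a0 a'0.
  have := congr1 (fun M : 'M[R]_2 => M 0 0) (FM a b a' b' a0 a'0).
  by rewrite !mx22_00.
have kM a b a' b' : 0 < a -> 0 < a' ->
    beta (a * a') (a * b' + b * a'^-1) =
    phi a b * beta a' b' + beta a b * (phi a' b')^-1.
  move=> a0 a'0.
  have := congr1 (fun M : 'M[R]_2 => M 0 1) (FM a b a' b' a0 a'0).
  by rewrite !mx22_01.
have df a : 0 < a -> differentiable (phi ^~ 0) a.
  move=> a0; apply: differentiableM => //.
  have oU : open [set s : R | 0 < s] by exact: open_gt.
  have C1 : Ck 1 [set s : R | 0 < s] (fun s => D (X s 0)).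
    have lineE s : (0, 0) + s *: (1, 0) = (s, 0) :> R * R.
      by congr pair; rewrite /= add0r /GRing.scale/= ?mulr1 ?mulr0.
    have lineU s : 0 < s -> 0 < ((0, 0) + s *: (1, 0) : R * R).1.
      by rewrite lineE.
    have := @Ck_line R (R * R)%type _ 1 _ _ _ _ _ oU lineU (Dsm 1%N).
    by apply: Ck_ext => // s _; rewrite lineE.
  by have [/(_ _ a0)] := Ck_entry 0 0 oU C1.
have m0 : rate (D diag_e) + 1 != 0 by rewrite addr_eq0.
have m1 : rate (D diag_e) + 1 != 1 by rewrite -subr_eq0 addrK.
have := endomorphism_form f0 fM kM df; rewrite /= mE => /(_ m0 m1) H.
move=> x Gx; have [x0] := G_eta Gx.
set a := x 0 0 in x0 *; set b := x 0 1 => xE.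
have [fE kE] := H a b x0.
have [_ ->] := G_eta (DG _ Gx); rewrite [in RHS]xE Dpq_mx22//.
set g := rate _ in H m0 m1 r0 r1 fE kE *.
have an0 := lt0r_neq0 x0.
have am1 : a `^ (g + 1) = a `^ g * a.
  by rewrite powRD ?an0 ?implybT// powRr1 ?ltW.
have D00 : D x 0 0 = a `^ g.
  by move: fE; rewrite /phi /X -xE am1 => /(mulIf an0).
rewrite D00; congr mx22.
have t0 : 0 < a `^ g by exact: powR_gt0.
set A := D diag_e 0 0; have A0 : 0 < A by exact: D0.
have gA : expR g = A by rewrite /g /rate lnK.
have AE0 : expR 1 ^+ 2 * A * A - 1 != 0.
  have := slope_denom_neq0 r1; rewrite gA; apply: contraNN => /eqP AE.
  have -> : expR 1 ^+ 2 * A - A^-1 = (expR 1 ^+ 2 * A * A - 1) / A.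
    by field; rewrite lt0r_neq0.
  by rewrite AE mul0r.
move: kE; rewrite /beta /X -xE D00 -/diag_e -/A !powRN am1 /slope -/A -/g.
rewrite !expRN expRD gA; set Y := D diag_e 0 1.
set t := a `^ g in t0 *; set E := expR 1 in e0 AE0 *.
have [tn0 En0 An0] := And3 (lt0r_neq0 t0) (lt0r_neq0 e0) (lt0r_neq0 A0).
move=> kE; have -> : D x 0 1 = (t * b + D x 0 1 / a - t * b) * a by field.
rewrite kE; field.
by rewrite m0 tn0 An0 AE0 an0 En0.
Qed.

End CrossedHomomorphisms.

(** * Triviality of a deformation *)

Section Deformations.
Set Implicit Arguments.
Unset Strict Implicit.
Context {R : realType}.
Implicit Types a b c d p q : R.

Lemma Gdiag_e : G (diag_e : 'M[R]_2).
Proof. by apply: Gmx22; exact: expR_gt0. Qed.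

Lemma Dpq_diag_e p q : Dpq p q diag_e =
  mx22 (expR p) (q * ((expR 1 ^+ 2 * expR p - (expR p)^-1) / (2 * (p + 1)))) 0
    (expR p)^-1.
Proof. by rewrite Dpq_mx22 ?expR_gt0// -expRM !mul1r mul0r subr0. Qed.

Lemma rate_Dpq p q : rate (Dpq p q diag_e) = p.
Proof. by rewrite /rate Dpq_diag_e mx22_00 expRK. Qed.

Lemma slope_Dpq p q : p != -1 -> slope (Dpq p q diag_e) = q.
Proof.
move=> p1; have d0 := slope_denom_neq0 p1.
rewrite /slope rate_Dpq Dpq_diag_e mx22_00 mx22_01.
set d := _ - _ in d0 *.
have p10 : p + 1 != 0 by rewrite addr_eq0.
by field; rewrite d0.
Qed.

Lemma deformation_local_form p q (DD : 'M[R]_2 -> R -> 'M[R]_2) :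
  p <> 0 -> p <> -1 -> deformation (Dpq p q) DD ->
  exists (eps : R) (g h : R -> R), local_form p q DD eps g h.
Proof.
move=> /eqP p0 /eqP p1 [DDsm DD0 DDc].
pose B s := DD diag_e s; pose g s := rate (B s); pose h s := slope (B s).
have BG s : G (B s) by have [+ _ _] := DDc s; apply; exact: Gdiag_e.
have A0 s : 0 < B s 0 0 by have [] := G_eta (BG s).
have AE s : B s 0 0 = expR (g s) by rewrite lnK ?posrE ?A0.
have CB k : Ck k setT B.
  have lineE s :
      ((expR 1, 0), 0) + s *: ((0, 0), 1) = ((expR 1, 0), s) :> R * R * R.
    by congr (_, _, _); rewrite /= ?add0r /GRing.scale/= /GRing.scale/=
      ?mulr1 ?mulr0 ?addr0.
  have lineU s : setT s ->
      0 < (((expR 1, 0), 0) + s *: ((0, 0), 1) : R * R * R).1.1.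
    by rewrite lineE expR_gt0.
  have := @Ck_line R (R * R * R)%type _ k _ _ _ _ _ openT lineU (DDsm k).
  by apply: Ck_ext => [|s _]; [exact: openT|rewrite lineE].
have CA k : Ck k setT (fun s => B s 0 0) by exact: Ck_entry openT (CB k).
have CX k : Ck k setT (fun s => B s 0 1) by exact: Ck_entry openT (CB k).
have Cg k : Ck k setT g by apply: Ck_ln (CA k) => //; exact: openT.
have gc : {for 0, continuous g} by exact: (Cg 0%N).
have g0 : g 0 = p by rewrite /g /B DD0 ?rate_Dpq//; exact: Gdiag_e.
have h0 : h 0 = q by rewrite /h /B DD0 ?slope_Dpq//; exact: Gdiag_e.
have near_g : \forall s \near 0, g s != 0 /\ g s != -1.
  have n0 : \forall s \near 0, g s != 0.
    by apply: (cvgr_neq0 (g 0) gc); rewrite g0.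
  have n1 : \forall s \near 0, g s + 1 != 0.
    apply: (@cvgr_neq0 _ _ _ (nbhs (0 : R)) _ (fun s => g s + 1) (g 0 + 1)).
      by apply: cvgD => //; exact: cvg_cst.
    by rewrite g0 addr_eq0.
  by near do rewrite -addr_eq0; near=> s; split; near: s.
have [eps /= eps0 epsP] := (nbhs_ballP _ _).1 near_g.
have gP s : s \in `]- eps, eps[ -> g s != 0 /\ g s != -1.
  rewrite in_itv/= -ltr_norml => se; apply: epsP.
  by rewrite /ball/= sub0r normrN.
have oI : open [set` `]- eps, (eps : R)[] by exact: interval_open.
exists eps, g, h; split => //.
- split=> k; first exact: Ck_subset (Cg k).
  apply: CkM => //.
    apply: CkM => //; last exact: Ck_subset (CX k).
    apply: CkM => //; first exact: Ck_cst.
    by apply: CkD => //; [exact: Ck_subset (Cg k)|exact: Ck_cst].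
  apply: CkV => //.
    by move=> s /gP[_ gs]; rewrite AE slope_denom_neq0.
  apply: CkD => //.
    by apply: CkM => //; [exact: Ck_cst|exact: Ck_subset (CA k)].
  apply: CkN => //; apply: CkV => //; last exact: Ck_subset (CA k).
  by move=> s _; rewrite gt_eqF.
- by move=> s /gP[/eqP ? /eqP ?].
- by move=> x s Gx /gP[gs0 gs1]; apply: (crossed_hom_Dpq (DDc s)).
Unshelve. all: by end_near. Qed.

(** On the neighbourhood of 0 where [g] equals [p], the endomorphisms attached
    to the deformation are conjugate under a curve of unipotent matrices. *)
Lemma trivial_deformation_of_derivative_vanishes p q DD eps g h :
  p <> -1 -> local_form p q DD eps g h -> derivative_vanishes eps g ->
  trivial_deformation (Dpq p q) DD.
Proof.
move=> /eqP p1 [eps0 [Cg Ch] [g0 h0] gP DE] [c [d [/andP[c0 d0] cd g'0]]].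
have m0 : p + 1 != 0 by rewrite addr_eq0.
have gp s : s \in `]c, d[ -> g s = p.
  move=> sI; rewrite -g0.
  apply: (@derive0_cst R g c d) => //; last by rewrite in_itv/= c0.
  move=> x xI; have [dg _] := Cg 1%N.
  rewrite -(g'0 x xI) derive1E; apply: derivableP.
  exact/derivable1_diffP/dg/cd.
pose e := Num.min (- c) d.
have e0 : 0 < e by rewrite lt_min oppr_gt0 c0.
have eI s : s \in `]- e, e[ -> s \in `]c, d[.
  rewrite !in_itv/= /e ltrNl !lt_min => /andP[/andP[? ?] /andP[? ?]].
  by apply/andP; split; lra.
(* Conjugation by the unipotent matrix of corner [u s] turns [q] into
   [q - 2 * (p + 1) * u s]. *)
pose u s := (q - h s) * (2 * (p + 1))^-1.
exists e, (fun s => mx22 1 (u s) 0 1^-1); split => //.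
- split=> [k|s _]; last exact: Gmx22.
  have oI : open [set` `]- e, (e : R)[] by exact: interval_open.
  have Cu : Ck k `]- e, e[ u.
    apply: CkM => //; last exact: Ck_cst.
    apply: CkD => //; first exact: Ck_cst.
    by apply: CkN => //; apply: Ck_subset (Ch k) => s /eI/cd.
  have := CkD oI (@Ck_cst _ _ k _ (1 : 'M[R]_2))
    (Ck_scalel (mx22 0 1 0 0) oI Cu).
  apply: Ck_ext => // s _.
  by apply/matrixP => -[[|[|//]] ?] [[|[|//]] ?];
    rewrite !mxE invr1//= ?mulr0 ?mulr1 ?addr0 ?add0r.
- by rewrite /u h0 subrr mul0r invr1 mx22_1.
move=> x s Gx sI; rewrite DE//; last exact/cd/eI.
rewrite gp; last exact: eI.
have [x0 xE] := G_eta Gx.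
rewrite xE; set a := x 0 0 in x0 *; set b := x 0 1.
have an0 := lt0r_neq0 x0; rewrite !Dpq_mx22//.
have t0 : a `^ p != 0 by rewrite lt0r_neq0// powR_gt0.
set t := a `^ p in t0 *.
rewrite !mx22V ?oner_neq0// !mx22M; congr mx22; rewrite /u; field => //;
  by rewrite an0 t0 ?m0.
Qed.

(** The rate is the logarithm of a diagonal entry, and conjugation by a
    triangular matrix preserves diagonal entries. *)
Lemma derivative_vanishes_of_trivial_deformation p q DD eps g h :
  local_form p q DD eps g h -> trivial_deformation (Dpq p q) DD ->
  derivative_vanishes eps g.
Proof.
move=> [eps0 [Cg Ch] [g0 h0] gP DE] [e [tau [e0 [_ tauG] _ DT]]].
pose m := Num.min e eps.
have mI s : s \in `]- m, m[ -> (s \in `]- e, e[) /\ (s \in `]- eps, eps[).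
  rewrite !in_itv/= /m ltrNl !lt_min => /andP[/andP[? ?] /andP[? ?]].
  by split; apply/andP; split; lra.
have gE s : s \in `]- m, m[ -> g s = p.
  move=> /mI[se seps]; have Ge := Gdiag_e.
  have := DT _ _ Ge se; rewrite DE//.
  have [t0 ->] := G_eta (tauG _ se); move: t0; set t := tau s 0 0 => t0.
  have tn0 := lt0r_neq0 t0.
  rewrite !Dpq_diag_e => /(congr1 (fun M : 'M[R]_2 => M 0 0)).
  rewrite /diag_e !mx22V ?gt_eqF ?expR_gt0// !mx22M !mx22_00 => H.
  apply: expR_inj; rewrite H; field.
  by rewrite tn0 gt_eqF ?expR_gt0.
have m0 : 0 < m by rewrite lt_min e0.
exists (- m), m; split; first by rewrite oppr_lt0 m0.
  by move=> s /mI[].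
move=> s sI; rewrite derive1E -(derive_cst p s (1 : R)); apply: near_eq_derive.
have oI : open [set` `]- m, (m : R)[] by exact: interval_open.
by apply: filterS (open_nbhs_nbhs (conj oI sI)) => r /gE.
Qed.

End Deformations.

Theorem theorem4p6 (R : realType) (p q : R) (hp0 : p <> 0) (hp1 : p <> -1)
    (DD : 'M[R]_2 -> R -> 'M[R]_2) (hDD : deformation (Dpq p q) DD) :
  (exists (eps : R) (g h : R -> R), local_form p q DD eps g h) /\
  (forall (eps : R) (g h : R -> R), local_form p q DD eps g h ->
     (derivative_vanishes eps g -> trivial_deformation (Dpq p q) DD) /\
     (~ derivative_vanishes eps g -> ~ trivial_deformation (Dpq p q) DD)).
Proof.
split; first exact: deformation_local_form.
move=> eps g h gh; split.
  exact: trivial_deformation_of_derivative_vanishes hp1 gh.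
by move=> ng /(derivative_vanishes_of_trivial_deformation gh).
Qed.
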